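(* Let $M$ be a positive integer. There exists an equal norm tight integer frame with $M+1$ elements in $\mathcal{H}_M$ if and only if $M+1$ is the sum of $1$, $2$, $4$, or $8$ odd squares.
   Context: $\mathcal{H}_M$ is the real $M$-dimensional Hilbert space, identified with $\mathbb{R}^M$ via a fixed orthonormal basis. An equal norm tight integer frame (ENTIF) with $N$ elements in $\mathcal{H}_M$ is an $M\times N$ integer matrix $A$ of rank $M$ with $AA^T=\lambda I_M$ for some $\lambda>0$ and all columns of the same Euclidean norm. *)

(* Defs.v *)
From HB Require Import structures.
From mathcomp Require Import all_boot all_order all_algebra.
Set Implicit Arguments. Unset Strict Implicit. Unset Printing Implicit Defensive.
Import Order.TTheory GRing.Theory Num.Theory.
Local Open Scope ring_scope.

(* Equal norm tight integer frame with N elements in H_M (= R^M):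
   an M x N integer matrix A of rank M (rank computed over Q, equivalently R),
   with A A^T = lambda I_M for some lambda > 0, and all columns of equal
   Euclidean norm (equivalently, equal squared norm). Since A has integer
   entries, lambda is necessarily an integer. *)
Definition ENTIF (M N : nat) (A : 'M[int]_(M, N)) : Prop :=
  [/\ \rank (map_mx (intr : int -> rat) A) = M,
      exists2 lambda : int, 0 < lambda & A *m A^T = lambda%:M
    & forall j j' : 'I_N, \sum_(i < M) A i j ^+ 2 = \sum_(i < M) A i j' ^+ 2].

Definition sum_of_odd_squares (n k : nat) : Prop :=
  exists a : 'I_k -> nat, (forall i, odd (a i)) /\ (\sum_(i < k) (a i) ^ 2)%N = n.

(* Main.v *)
Require Import Defs.
From mathcomp Require Import all_boot all_order all_algebra.
From mathcomp Require Import zify ring.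
Set Implicit Arguments. Unset Strict Implicit. Unset Printing Implicit Defensive.
Import Order.TTheory GRing.Theory Num.Theory.
Local Open Scope ring_scope.

(* Write n = M + 1.  The kernel of a frame with n elements in dimension M is a
   line, and equality of the column norms forces it to be spanned by a vector e
   with entries 1 and -1.  Adjoining e as a row and taking determinants shows
   that lambda^M n is a square.  If M is even, n is an odd square.  If M is odd,
   lambda n is a square, so rescaling gives a rational n x n matrix C with
   C C^T = n I.  When n = 2 mod 4, Lagrange's theorem makes n times a sum of four
   squares isometric to a sum of four squares, and cancelling these (as in the
   Bruck-Ryser theorem) shows that n is a sum of two rational, hence integer,
   squares.  When 4 divides n, Lagrange's theorem applied to n/4 or (n - 4)/4
   gives 4 or 8 odd squares.
   Conversely, each of the conditions gives an integer matrix H with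
   H H^T = n I, block diagonal with blocks of size 1, 2 or 4.  A rational
   reflection moves its first row to the all-ones vector; the other rows, after
   clearing denominators, form the frame. *)

(** * Lagrange's four-square theorem *)

Definition sum_of_4_squares (n : int) : Prop :=
  exists a b c d : int, n = a ^+ 2 + b ^+ 2 + c ^+ 2 + d ^+ 2.

(** Euler's identity: the witnesses are the components of the quaternion product of x + yi + zj + tk
    and the conjugate of a + bi + cj + dk, and the norm is multiplicative. *)
Lemma sum_of_4_squaresM m n :
  sum_of_4_squares m -> sum_of_4_squares n -> sum_of_4_squares (m * n).
Proof.
move=> [a [b [c [d ->]]]] [x [y [z [t ->]]]].
exists (a * x + b * y + c * z + d * t), (a * y - b * x + c * t - d * z),
  (a * z - c * x + d * y - b * t), (a * t - d * x + b * z - c * y).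
ring.
Qed.

Lemma int_parity (x : int) : exists q (b : bool), x = 2 * q + b%:Z.
Proof. by exists (x %/ 2)%Z, ((x %% 2)%Z == 1); lia. Qed.

(** An even number of the four roots are odd, so they split into pairs of equal parity; half-sums
    and half-differences of each pair give the representation of [m]. *)
Lemma sum_of_4_squares_half m :
  sum_of_4_squares (2 * m) -> sum_of_4_squares m.
Proof.
have key (a b c d : int) (r s : bool) :
    2 * m = (2 * a + r%:Z) ^+ 2 + (2 * b + r%:Z) ^+ 2
          + (2 * c + s%:Z) ^+ 2 + (2 * d + s%:Z) ^+ 2 ->
    sum_of_4_squares m.
  move=> e; exists (a + b + r%:Z), (a - b), (c + d + s%:Z), (c - d).
  apply: (@mulfI _ 2) => //; rewrite e; ring.
move=> [a [b [c [d]]]].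
have [a' [ra ->]] := int_parity a; have [b' [rb ->]] := int_parity b.
have [c' [rc ->]] := int_parity c; have [d' [rd ->]] := int_parity d.
move=> e.
have [eab|nab] := eqVneq ra rb.
  have ecd : rc = rd by move: e; case: ra rb rc rd eab => [] [] [] [] //; nia.
  by apply: (key a' b' c' d' rb rd); rewrite e eab ecd.
have [eac|nac] := eqVneq ra rc.
  have ebd : rb = rd by move: e; case: ra rb rc rd nab eac => [] [] [] [] //; nia.
  by apply: (key a' c' b' d' rc rd); rewrite e eac ebd; ring.
have ebc : rb = rc by case: ra rb rc nab nac {e} => [] [] [].
have ead : ra = rd by move: e; case: ra rb rc rd nab nac ebc => [] [] [] [] //; nia.
by apply: (key b' c' a' d' rc rd); rewrite e ebc ead; ring.
Qed.

Lemma centered_residue (m x : int) : 0 < m ->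
  exists q y, [/\ x = m * q + y, - m <= 2 * y & 2 * y <= m].
Proof.
move=> m0; have e := divz_eq x m; have := modz_ge0 x (lt0r_neq0 m0).
have := ltz_pmod x m0; move: e.
set q := (x %/ m)%Z; set r := (x %% m)%Z => e r1 r0.
have [rm|rm] := leP (2 * r) m; first by exists q, r; split; lia.
by exists (q + 1), (r - m); split; lia.
Qed.

Lemma sqr_lt_of_centered (m y : int) : (m %% 2)%Z = 1 ->
  - m <= 2 * y -> 2 * y <= m -> 4 * y ^+ 2 < m ^+ 2.
Proof.
move=> mo y1 y2; have y3 : 0 < m - 2 * y by lia.
have y4 : 0 < m + 2 * y by lia.
rewrite -subr_gt0; have -> : m ^+ 2 - 4 * y ^+ 2 = (m - 2 * y) * (m + 2 * y) by ring.
exact: mulr_gt0.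
Qed.

(** Descent on the multiple [m]: an even [m] is halved; for odd [m > 1], reducing the roots modulo
    [m] gives a sum of squares [m * r] with [0 < r < m], and Euler's identity turns this into a
    representation of [r * p]. *)
Lemma four_squares_descent (p m : nat) : prime p -> (0 < m < p)%N ->
  sum_of_4_squares (m * p)%:Z -> sum_of_4_squares p%:Z.
Proof.
move=> pp; elim/ltn_ind: m => m IH /andP[m0 mp] h.
case: (posnP (m %% 2)) => [m2|m2].
  apply: (IH (m %/ 2)%N); [lia|lia|].
  by apply: sum_of_4_squares_half; have -> // : 2 * (m %/ 2 * p)%:Z = (m * p)%:Z by nia.
have [m1|m1] := eqVneq m 1%N; first by rewrite m1 mul1n in h.
move: h => [a [b [c [d]]]].
have m0' : 0 < m%:Z by lia.
have [qa [ya [-> a1 a2]]] := centered_residue a m0'.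
have [qb [yb [-> b1 b2]]] := centered_residue b m0'.
have [qc [yc [-> c1 c2]]] := centered_residue c m0'.
have [qd [yd [-> d1 d2]]] := centered_residue d m0'.
have mo : (m%:Z %% 2)%Z = 1 by lia.
rewrite PoszM => e.
(* The sum of the squared residues divided by [m], expanded so as to avoid division. *)
pose r := p%:Z - m%:Z * (qa ^+ 2 + qb ^+ 2 + qc ^+ 2 + qd ^+ 2)
  - 2 * (qa * ya + qb * yb + qc * yc + qd * yd).
have er : m%:Z * r = ya ^+ 2 + yb ^+ 2 + yc ^+ 2 + yd ^+ 2.
  by rewrite /r !mulrBr e; ring.
have := sqr_lt_of_centered mo a1 a2; have := sqr_lt_of_centered mo b1 b2;
have := sqr_lt_of_centered mo c1 c2; have := sqr_lt_of_centered mo d1 d2.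
move=> d3 c3 b3 a3.
have rm : r < m%:Z by rewrite -(ltr_pM2l m0') er; clear -d3 c3 b3 a3 m0'; lia.
have r0 : 0 <= r by rewrite -(pmulr_rge0 _ m0') er !addr_ge0 ?sqr_ge0.
(* If all residues vanish, then [m] divides [p], impossible for 1 < m < p. *)
have [z|rn0] := eqVneq r 0.
  have z4 : [/\ ya = 0, yb = 0, yc = 0 & yd = 0].
    have /eqP : ya ^+ 2 + yb ^+ 2 + yc ^+ 2 + yd ^+ 2 = 0 by rewrite -er z mulr0.
    rewrite !paddr_eq0 ?addr_ge0 ?sqr_ge0 // !sqrf_eq0.
    by case/andP=> /andP[/andP[/eqP-> /eqP->] /eqP->] /eqP->.
  case: z4 => *; subst ya yb yc yd.
  have : (m %| p)%N.
    have : (m%:Z %| p%:Z)%Z.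
      apply/dvdzP; exists (qa ^+ 2 + qb ^+ 2 + qc ^+ 2 + qd ^+ 2).
      by move: z; rewrite /r; clear; lia.
    by rewrite dvdzE.
  by case/primeP: pp => _ /[apply]; clear -m1 mp; lia.
have [r' er'] : exists r' : nat, r = r'%:Z by exists `|r|%N; clear -r0; lia.
apply: (IH r'); [clear -er' rm; lia|clear -er' rn0 r0 rm mp; lia|].
(* Euler's identity for the roots and their residues, each component divided by [m]. *)
exists (qa * ya + qb * yb + qc * yc + qd * yd + r),
  (qa * yb - qb * ya + qc * yd - qd * yc),
  (qa * yc - qc * ya + qd * yb - qb * yd), (qa * yd - qd * ya + qb * yc - qc * yb).
rewrite PoszM -er'.
have -> : p%:Z = r + m%:Z * (qa ^+ 2 + qb ^+ 2 + qc ^+ 2 + qd ^+ 2)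
  + 2 * (qa * ya + qb * yb + qc * yc + qd * yd) by rewrite /r; ring.
transitivity (r ^+ 2 + (m%:Z * r) * (qa ^+ 2 + qb ^+ 2 + qc ^+ 2 + qd ^+ 2)
  + 2 * r * (qa * ya + qb * yb + qc * yc + qd * yd)); first by ring.
by rewrite er; ring.
Qed.

(** Pigeonhole: for 0 <= i <= h = (p - 1)/2, the i^2 and the -(i^2 + 1) each take h + 1 distinct
    values modulo [p], and 2(h + 1) > p. *)
Lemma sqr_add_sqr_eqm1_Fp (p : nat) : prime p -> odd p ->
  exists a b : nat, [/\ (2 * a < p)%N, (2 * b < p)%N & (p %| a ^ 2 + b ^ 2 + 1)%N].
Proof.
move=> pp op; pose h := (p %/ 2)%N.
have hp : (2 * h + 1)%N = p by rewrite /h; lia.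
have p0 := prime_gt0 pp.
have inj (i j : 'I_h.+1) : (i ^ 2 = j ^ 2 %[mod p])%N -> i = j.
  wlog ij : i j / (i <= j)%N.
    move=> W e; case: (leqP i j) => ij; first exact: W.
    by symmetry; apply: W => //; lia.
  move=> e; apply/val_inj/eqP; rewrite eqn_leq ij /= leqNgt; apply/negP => ji.
  have : (p %| j ^ 2 - i ^ 2)%N by rewrite -eqn_mod_dvd ?leq_exp2r // e.
  rewrite subn_sqr Euclid_dvdM //; have := ltn_ord i; have := ltn_ord j.
  by move=> ? ?; rewrite !gtnNdvd //; lia.
pose f (i : 'I_h.+1) : 'I_p := Ordinal (ltn_pmod (i ^ 2) p0).
(* Adding [p * p] keeps the natural subtraction from truncating. *)
pose g (i : 'I_h.+1) : 'I_p := Ordinal (ltn_pmod (p * p - (i ^ 2 + 1)) p0).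
have fi : injective f by move=> i j [] /inj.
have bnd (i : 'I_h.+1) : (i ^ 2 + 1 <= p * p)%N by have := ltn_ord i; nia.
have gi : injective g.
  move=> i j [] /(congr1 (fun x => (x + (i ^ 2 + j ^ 2 + 1)) %% p)%N).
  rewrite !modnDml => e; apply: inj; symmetry.
  rewrite -[LHS](modnMDl p) -[RHS](modnMDl p).
  have := bnd i; have := bnd j => bj bi.
  rewrite (_ : p * p + j ^ 2 = p * p - (i ^ 2 + 1) + (i ^ 2 + j ^ 2 + 1))%N; last by lia.
  by rewrite e; congr (_ %% _)%N; lia.
have [] := boolP [disjoint [set f i | i : 'I_h.+1] & [set g i | i : 'I_h.+1]].
  move=> dj; have := max_card ([set f i | i : 'I_h.+1] :|: [set g i | i : 'I_h.+1]).
  move: dj; rewrite -leq_card_setU => /eqP ->.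
  by rewrite !card_imset // !card_ord; lia.
rewrite -setI_eq0 => /set0Pn [x /setIP[/imsetP[i _ ->] /imsetP [j _ [e]]]].
exists i, j; split; [by have := ltn_ord i; lia|by have := ltn_ord j; lia|].
rewrite /dvdn -addnA -modnDml e modnDml subnK ?bnd //.
by rewrite modnMl.
Qed.

Lemma four_squares (n : nat) : sum_of_4_squares n%:Z.
Proof.
have [->|n0] := posnP n; first by exists 0, 0, 0, 0.
elim/ltn_ind: n n0 => n IH n0.
have [->|n1] := eqVneq n 1%N; first by exists 1, 0, 0, 0.
have n1' : (1 < n)%N by lia.
have [p pp /dvdnP[m e]] : exists2 p, prime p & (p %| n)%N.
  by exists (pdiv n); [exact: pdiv_prime|exact: pdiv_dvd].
have p1 := prime_gt1 pp.
rewrite e PoszM; apply: sum_of_4_squaresM; first by apply: IH; nia.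
move=> {n IH n0 n1 n1' m e}.
have [->|op] := even_prime pp; first by exists 1, 1, 0, 0.
have [a [b [ap bp /dvdnP [m e]]]] := sqr_add_sqr_eqm1_Fp pp op.
apply: (four_squares_descent (m := m) pp); first by have := prime_gt1 pp; nia.
by exists a%:Z, b%:Z, 1, 0; rewrite -e; lia.
Qed.

(** * Sums of odd, rational and integer squares *)

Lemma sum_of_odd_squares_seq n k :
  sum_of_odd_squares n k <->
  exists s : seq nat, [/\ size s = k, all odd s & (\sum_(x <- s) x ^ 2)%N = n].
Proof.
split=> [[a [oa <-]]|[s [<- os <-]]].
  exists (codom a); split; first by rewrite size_codom card_ord.
    by apply/allP => _ /codomP[i ->].
  by rewrite codomE big_map big_enum.
exists (fun i => nth 0%N s i); split=> [i|]; first exact: (all_nthP 0%N os).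
by rewrite (big_nth 0%N) big_mkord.
Qed.

(** A Hadamard matrix of order 4 applied to the roots of n/4 multiplies the sum of squares by 4; the
    new roots all have the parity of a + b + c + d, which is odd because n/4 is. *)
Lemma sum_of_odd_squares4 n : (n %% 8 = 4)%N -> sum_of_odd_squares n 4.
Proof.
move=> n4; have [a [b [c [d e]]]] := four_squares (n %/ 4).
have ne : n%:Z = 4 * (n %/ 4)%N%:Z by lia.
rewrite e in ne.
have oddS : odd `|a + b + c + d|.
  have [a' [ra ea]] := int_parity a; have [b' [rb eb]] := int_parity b.
  have [c' [rc ec]] := int_parity c; have [d' [rd ed]] := int_parity d.
  move: ne n4 {e}; rewrite ea eb ec ed.
  by case: ra rb rc rd {ea eb ec ed} => [] [] [] [] *; lia.
apply/sum_of_odd_squares_seq.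
exists (map absz [:: a + b + c + d; a + b - c - d; a - b + c - d; a - b - c + d]).
split=> //; first by rewrite /= oddS; clear -oddS; lia.
rewrite big_map !big_cons big_nil; apply/eqP; rewrite -eqz_nat ne !PoszD -!abszX !abszE.
by rewrite !ger0_norm ?sqr_ge0 //; apply/eqP; ring.
Qed.

Lemma sum_of_odd_squares8 n : (0 < n)%N -> (n %% 8 = 0)%N -> sum_of_odd_squares n 8.
Proof.
move=> n0 n8; have n4 : ((n - 4) %% 8 = 4)%N by lia.
have /sum_of_odd_squares_seq [s [ss os es]] := sum_of_odd_squares4 n4.
apply/sum_of_odd_squares_seq; exists [:: 1, 1, 1, 1 & s]%N; split; rewrite /= ?ss //.
by rewrite !big_cons es; lia.
Qed.

(* Davenport-Cassels descent: the line through a rational point of the circle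
   [x^2 + y^2 = n] and the nearest integer point meets the circle again in a
   point of smaller denominator. *)
Lemma two_rational_squares_int (n : int) (r : nat) (x y : int) : (0 < r)%N ->
  n * r%:Z ^+ 2 = x ^+ 2 + y ^+ 2 -> exists a b : int, n = a ^+ 2 + b ^+ 2.
Proof.
elim/ltn_ind: r x y => r IH x y r0 e.
have rZ : 0 < r%:Z by lia.
have [a [x' [ex x1 x2]]] := centered_residue x rZ.
have [b [y' [ey y1 y2]]] := centered_residue y rZ.
(* The second intersection is [(t * x + s * a, t * y + s * b)] over [r']. As [r * r'] is the sum of
   the squared residues, [r'] is at most r/2. *)
pose t := a ^+ 2 + b ^+ 2 - n.
pose s := 2 * (n * r%:Z - x * a - y * b).
pose r' := t * r%:Z + s.
have er' : r%:Z * r' = x' ^+ 2 + y' ^+ 2.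
  have -> : x' = x - r%:Z * a by rewrite ex; ring.
  have -> : y' = y - r%:Z * b by rewrite ey; ring.
  transitivity (r%:Z ^+ 2 * (a ^+ 2 + b ^+ 2) + n * r%:Z ^+ 2
     - 2 * r%:Z * (x * a + y * b)); first by rewrite /r' /t /s; ring.
  by rewrite e; ring.
have r'0 : 0 <= r' by rewrite -(pmulr_rge0 _ rZ) er' addr_ge0 ?sqr_ge0.
have bnd z : - r%:Z <= 2 * z -> 2 * z <= r%:Z -> 4 * z ^+ 2 <= r%:Z ^+ 2.
  move=> z1 z2; rewrite -subr_ge0.
  have -> : r%:Z ^+ 2 - 4 * z ^+ 2 = (r%:Z - 2 * z) * (r%:Z + 2 * z) by ring.
  by apply: mulr_ge0; clear -z1 z2; lia.
have bx := bnd _ x1 x2; have bY := bnd _ y1 y2.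
have r2 : 0 < r%:Z ^+ 2 by exact: exprn_gt0.
have r'r : r' < r%:Z by rewrite -(ltr_pM2l rZ) er'; clear -bx bY r2; lia.
have [z|rn0] := eqVneq r' 0.
  have : x' ^+ 2 + y' ^+ 2 = 0 by rewrite -er' z mulr0.
  move/eqP; rewrite paddr_eq0 ?sqr_ge0 // !sqrf_eq0 => /andP[/eqP x0 /eqP y0].
  exists a, b; apply: (@mulIf _ (r%:Z ^+ 2)); first by rewrite lt0r_neq0.
  by rewrite e ex ey x0 y0; ring.
have r'E : r' = `|r'|%N%:Z by rewrite gez0_abs.
apply: (IH `|r'|%N _ (t * x + s * a) (t * y + s * b)).
- by clear -r'r r'0; lia.
- by clear -rn0; lia.
rewrite -r'E.
transitivity (t ^+ 2 * (n * r%:Z ^+ 2) + 2 * t * s * n * r%:Z + n * s ^+ 2).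
  by rewrite /r'; ring.
rewrite e; transitivity (t ^+ 2 * (x ^+ 2 + y ^+ 2) + 2 * t * s * (x * a + y * b)
   + s ^+ 2 * (a ^+ 2 + b ^+ 2)); last by ring.
have -> : 2 * t * s * n * r%:Z = t * s * (s + 2 * (x * a + y * b)) by rewrite /s; ring.
have -> : n * s ^+ 2 = s ^+ 2 * (a ^+ 2 + b ^+ 2) - t * s ^+ 2 by rewrite /t; ring.
ring.
Qed.

Lemma two_rational_squares (n : nat) (x y : rat) : n%:R = x ^+ 2 + y ^+ 2 ->
  exists a b : nat, (n = a ^ 2 + b ^ 2)%N.
Proof.
move=> e; pose r := (`|denq x| * `|denq y|)%N.
have [dx dy] : (denq x != 0) /\ (denq y != 0) by rewrite !denq_neq0.
have r0 : (0 < r)%N by rewrite muln_gt0 !absz_gt0 dx.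
have rE : r%:Z = denq x * denq y by rewrite PoszM !absz_denq.
have [|a [b eab]] := @two_rational_squares_int n%:Z r (numq x * denq y) (numq y * denq x) r0.
  apply: (@intr_inj rat); rewrite rE.
  rewrite !(rmorphM, rmorphXn, rmorphD) /= ?rmorphM /=.
  rewrite -[n%:Z%:~R]/(n%:R) e !numqE; ring.
exists `|a|%N, `|b|%N; apply/eqP; rewrite -eqz_nat eab PoszD -!abszX !abszE.
by rewrite !ger0_norm ?sqr_ge0.
Qed.

Lemma rational_square_nat (n : nat) (x : rat) : n%:R = x ^+ 2 ->
  exists k, n = (k ^ 2)%N.
Proof.
move=> e; have : n%:Z * denq x ^+ 2 = numq x ^+ 2.
  apply: (@intr_inj rat); rewrite rmorphM !rmorphXn /= -[n%:Z%:~R]/(n%:R) e.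
  by rewrite -exprMn -numqE.
move/(congr1 absz); rewrite abszM !abszX /= => e'.
have : (`|denq x| %| `|numq x|)%N by rewrite -(@dvdn_pexp2r _ _ 2) // -e' dvdn_mull.
case/dvdnP => k ek; exists k; apply/eqP.
rewrite -(@eqn_pmul2r (`|denq x| ^ 2)%N) ?expn_gt0 ?absz_gt0 ?denq_neq0 //.
by rewrite e' ek expnMn.
Qed.

(** * Matrices with [A A^T] scalar *)

Lemma mulmx_tr_scalarC (F : fieldType) n (A : 'M[F]_n) (c : F) : c != 0 ->
  A *m A^T = c%:M -> A^T *m A = c%:M.
Proof.
move=> c0 e; have : A *m (c^-1 *: A^T) = 1%:M.
  by rewrite -scalemxAr e scale_scalar_mx mulVf.
move/mulmx1C; rewrite -scalemxAl => /(congr1 (fun X => c *: X)).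
by rewrite scalerA mulfV // scale1r scalemx1.
Qed.

Lemma mul_tr_scalar_rank (F : fieldType) m n (A : 'M[F]_(m, n)) (c : F) : c != 0 ->
  A *m A^T = c%:M -> \rank A = m.
Proof.
move=> c0 e; apply/eqP/row_freeP; exists (c^-1 *: A^T).
by rewrite -scalemxAr e scale_scalar_mx mulVf.
Qed.

Lemma block_diag_mul_tr (R : comNzRingType) (c : R) d m : (d %| m)%N ->
  (exists H : 'M[R]_d, H *m H^T = c%:M) -> exists H : 'M[R]_m, H *m H^T = c%:M.
Proof.
case/dvdnP=> k -> {m} [H eH]; elim: k => [|k [G eG]].
  by exists 0; apply/matrixP; case.
exists (block_mx H 0 0 G : 'M_(d + k * d)).
rewrite tr_block_mx !trmx0 mulmx_block !mul0mx !mulmx0 !addr0 add0r eH eG.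
by rewrite -scalar_mx_block.
Qed.

Lemma two_squares_mul_tr (R : comNzRingType) (a b : R) :
  exists H : 'M[R]_2, H *m H^T = (a ^+ 2 + b ^+ 2)%:M.
Proof.
exists (\matrix_(i, j) nth 0 (nth [::] [:: [:: a; b]; [:: - b; a]] i) j).
apply/matrixP => i j; rewrite !mxE !big_ord_recl big_ord0 !mxE /=.
by case: i j => [[|[|?]] ?] [[|[|?]] ?] //=; rewrite ?mulr1n ?mulr0n; ring.
Qed.

(** The rows are the coordinates of q, iq, jq, kq for the quaternion q = a + bi + cj + dk. *)
Lemma four_squares_mul_tr (R : comNzRingType) (a b c d : R) :
  exists H : 'M[R]_4, H *m H^T = (a ^+ 2 + b ^+ 2 + c ^+ 2 + d ^+ 2)%:M.
Proof.
exists (\matrix_(i, j) nth 0 (nth [::] [:: [:: a; b; c; d]; [:: - b; a; - d; c];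
  [:: - c; d; a; - b]; [:: - d; - c; b; a]] i) j).
apply/matrixP => i j; rewrite !mxE !big_ord_recl big_ord0 !mxE /=.
by case: i j => [[|[|[|[|?]]]] ?] [[|[|[|[|?]]]] ?] //=;
  rewrite ?mulr1n ?mulr0n; ring.
Qed.

(** By induction: the determinant is affine in the first sign, with slope the determinant of the
    remaining block, nonzero by induction; so it cannot vanish at both 1 and -1. *)
Lemma exists_sign_diag_unitmx (F : numFieldType) m (P : 'M[F]_m) :
  exists2 d : 'rV[F]_m, forall i, d 0 i ^+ 2 = 1 & P + diag_mx d \in unitmx.
Proof.
elim: m P => [|m IH] P; first by exists 0 => [[]//|]; rewrite unitmxE det_mx00 unitr1.
have [d d1 ud] := IH (row' ord0 (col' ord0 P)).
pose D (e : F) : 'rV[F]_m.+1 := \row_j oapp (d 0) e (unlift ord0 j).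
have D1 (e : F) i : e ^+ 2 = 1 -> D e 0 i ^+ 2 = 1.
  by rewrite mxE; case: unliftP => [j|] _ //=.
suff [h|h] : P + diag_mx (D 1) \in unitmx \/ P + diag_mx (D (-1)) \in unitmx.
- by exists (D 1) => // i; rewrite D1 ?expr1n.
- by exists (D (-1)) => // i; rewrite D1 ?sqrrN ?expr1n.
rewrite !unitmxE !unitfE; apply/orP; rewrite -negb_and.
apply: contraTN ud => /andP[/eqP h1 /eqP h2]; rewrite unitmxE unitfE negbK.
have cofE e j :
    cofactor (P + diag_mx (D e)) ord0 j = cofactor (P + diag_mx (D 0)) ord0 j.
  congr (_ * \det _); apply/matrixP => i l; rewrite !mxE; congr (_ + _ *+ _).
  by rewrite liftK.
have cof0 : cofactor (P + diag_mx (D 0)) ord0 ord0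
    = \det (row' ord0 (col' ord0 P) + diag_mx d).
  rewrite /cofactor expr0 mul1r; congr (\det _); apply/matrixP => i l.
  by rewrite !mxE liftK /= (inj_eq lift_inj).
have detE e : \det (P + diag_mx (D e)) = \det (P + diag_mx (D 0))
    + e * \det (row' ord0 (col' ord0 P) + diag_mx d).
  rewrite (expand_det_row _ ord0) [in RHS](expand_det_row _ ord0) !big_ord_recl /=.
  rewrite cofE cof0 !mxE unlift_none /= !mulr1n addr0 mulrDl -!addrA; congr (_ + _).
  rewrite addrC; congr (_ + _); apply: eq_bigr => j _.
  by rewrite cofE !mxE.
have := detE 1; have := detE (-1); rewrite h1 h2 mul1r mulN1r => e1 e2.
move: e1 e2; set y := \det _; set x := \det _ => e1 e2.
have : 2 * x = 0 by rewrite -[RHS]subr0 [X in X - _]e2 [X in _ - X]e1; ring.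
by move/eqP; rewrite mulf_eq0 pnatr_eq0.
Qed.

(* The signs are chosen so that the square system asking the first [4 k]
   coordinates of [C x] to be, up to sign, those of [H x] is solvable for these
   coordinates of [x]; their squares then cancel. *)
Lemma bruck_ryser (m k n : nat) (C : 'M[rat]_m) : m = (k * 4 + 2)%N -> (0 < n)%N ->
  C *m C^T = n%:R%:M -> exists x y : rat, n%:R = x ^+ 2 + y ^+ 2.
Proof.
move=> em n0; subst m => eC; have nn0 : n%:R != 0 :> rat by rewrite pnatr_eq0 -lt0n.
have [H eH] : exists H : 'M[rat]_(k * 4), H *m H^T = n%:R%:M.
  apply: (@block_diag_mul_tr _ _ 4); first exact: dvdn_mull.
  have [a [b [c [d e]]]] := four_squares n.
  have [H eH] := four_squares_mul_tr (a%:~R : rat) b%:~R c%:~R d%:~R.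
  by exists H; rewrite eH -!rmorphXn -!rmorphD /= -e.
have eH' := mulmx_tr_scalarC nn0 eH; have eC' := mulmx_tr_scalarC nn0 eC.
have uH : H \in unitmx.
  by rewrite -row_full_unit /row_full (mul_tr_scalar_rank nn0 eH).
have [d d1 ud] := exists_sign_diag_unitmx (ulsubmx C *m invmx H).
set D := diag_mx d in ud.
have DD : D^T *m D = 1%:M.
  rewrite tr_diag_mx mulmx_diag -diag_const_mx; congr diag_mx.
  by apply/rowP => i; rewrite !mxE -expr2 d1.
(* The two free coordinates are (1, 0), of norm 1, so that [n] itself is left after cancellation;
   [u] solves the square system. *)
pose z : 'cV[rat]_2 := delta_mx 0 0.
pose u := invmx H *m (invmx (ulsubmx C *m invmx H + D) *m (- (ursubmx C *m z))).
have top : ulsubmx C *m u + ursubmx C *m z = - (D *m H *m u).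
  apply/eqP; rewrite -addr_eq0 addrAC -mulmxDl.
  have -> : ulsubmx C + D *m H = (ulsubmx C *m invmx H + D) *m H.
    by rewrite mulmxDl mulmxKV.
  by rewrite -mulmxA /u !mulKVmx // addNr.
move: u top => u top.
have [b eCx] : exists b, C *m col_mx u z = col_mx (- (D *m H *m u)) b.
  exists (dlsubmx C *m u + drsubmx C *m z).
  by rewrite -{1}[C]submxK mul_block_col top.
have : (C *m col_mx u z)^T *m (C *m col_mx u z) = n%:R *: ((col_mx u z)^T *m col_mx u z).
  by rewrite trmx_mul -mulmxA (mulmxA C^T) eC' mul_scalar_mx -scalemxAr.
rewrite eCx !tr_col_mx !mul_row_col.
have -> : (- (D *m H *m u))^T *m - (D *m H *m u) = n%:R *: (u^T *m u).
  have trN p (w : 'cV[rat]_p) : (- w)^T = - w^T by apply/matrixP => i j; rewrite !mxE.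
  rewrite trN mulNmx mulmxN opprK !trmx_mul -!mulmxA (mulmxA D^T) DD mul1mx.
  by rewrite (mulmxA H^T) eH' mul_scalar_mx -scalemxAr.
rewrite scalerDr => /addrI /matrixP /(_ 0 0).
rewrite !mxE !big_ord_recl !big_ord0 !mxE /=.
rewrite ?(mulr1, mulr0, addr0) => e.
by exists (b ord0 0), (b (lift ord0 ord0) 0); rewrite -e !expr2.
Qed.

(** * Frames with one redundant element *)

Lemma mul_tr_row00 (R : comNzRingType) n (v : 'rV[R]_n) :
  (v *m v^T) 0 0 = \sum_j v 0 j ^+ 2.
Proof. by rewrite mxE; apply: eq_bigr => j _; rewrite mxE expr2. Qed.

Lemma mul_tr_row00_eq0 (R : realDomainType) n (v : 'rV[R]_n) :
  (v *m v^T) 0 0 = 0 -> v = 0.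
Proof.
rewrite mul_tr_row00 => /eqP.
rewrite psumr_eq0 => [/allP e|j _]; last exact: sqr_ge0.
apply/rowP => j; rewrite [RHS]mxE; apply/eqP; rewrite -sqrf_eq0.
by apply: (implyP (e j _)); rewrite ?mem_index_enum.
Qed.

(* The reflection exchanging the first row of [H] with the all-ones vector,
   multiplied by the squared norm [q] of the vector [w] defining it. *)
Lemma first_row_const n (H : 'M[int]_n.+1) : H *m H^T = n.+1%:R%:M ->
  exists2 q : int, q != 0 &
  exists2 G : 'M[int]_n.+1, G *m G^T = (q ^+ 2 * n.+1%:R)%:M & row 0 G = const_mx q.
Proof.
move=> eH; pose o : 'rV[int]_n.+1 := const_mx 1.
pose u := row 0 H; pose w := u - o.
have [w0|wn0] := eqVneq w 0.
  exists 1 => //; exists H; first by rewrite expr1n mul1r.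
  by apply/eqP; rewrite -subr_eq0; apply/eqP.
pose q := (w *m w^T) 0 0; have eq : w *m w^T = q%:M by exact: mx11_scalar.
have q0 : q != 0 by apply: contra_neq wn0; exact: mul_tr_row00_eq0.
have [X eX] : exists X, X = w^T *m w by exists (w^T *m w).
pose T := q%:M - 2 *: X.
have Tt : T^T = T.
  by rewrite /T linearB linearZ /= tr_scalar_mx eX trmx_mul trmxK.
have XX : X *m X = q *: X.
  by rewrite eX -mulmxA (mulmxA w) eq mul_scalar_mx -scalemxAr.
have TT : T *m T = (q ^+ 2)%:M.
  rewrite /T mulmxBl mul_scalar_mx -scalemxAl mulmxBr mul_mx_scalar -scalemxAr XX.
  by apply/matrixP => i j; rewrite !mxE; ring.
have uu : u *m u^T = n.+1%:R%:M.
  apply/matrixP => i j; rewrite !ord1 mul_tr_row00.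
  have /matrixP/(_ 0 0) := eH; rewrite !mxE => <-.
  by apply: eq_bigr => k _; rewrite !mxE expr2.
have oo : o *m o^T = n.+1%:R%:M.
  apply/matrixP => i j; rewrite !ord1 mul_tr_row00 !mxE.
  by rewrite (eq_bigr (fun=> 1)) ?sumr_const ?card_ord // => k _; rewrite mxE expr1n.
exists q => //; exists (H *m T).
  rewrite trmx_mul Tt mulmxA -(mulmxA H) TT mul_mx_scalar -scalemxAl eH.
  by rewrite scale_scalar_mx.
rewrite row_mul -/u /T mulmxBr mul_mx_scalar -scalemxAr eX mulmxA.
pose t := (u *m o^T) 0 0; have et : u *m o^T = t%:M by exact: mx11_scalar.
have et' : o *m u^T = t%:M by rewrite -tr_scalar_mx -et trmx_mul trmxK.
have euw : u *m w^T = (n.+1%:R - t)%:M by rewrite linearB /= mulmxBr uu et raddfB.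
(* As [u] and [o] have equal norms, [q] is twice the product of [u] and [w]; hence [T] sends [u] to
   [q] times u - w = o. *)
have qE : q = 2 * (n.+1%:R - t).
  have := eq; rewrite {1}/w mulmxBl euw linearB mulmxBr et' oo -!raddfB /=.
  by move=> /matrixP/(_ 0 0); rewrite !mxE !mulr1n => <-; ring.
rewrite euw mul_scalar_mx scalerA -qE -scalerBr /w opprB addrCA subrr addr0.
by apply/rowP => j; rewrite !mxE mulr1.
Qed.

(** The columns of [G] have equal norms because [G^T *m G] is scalar too; deleting the constant row
    [q] lowers each squared norm by [q ^+ 2]. *)
Lemma entif_of_mul_tr M (H : 'M[int]_M.+1) : H *m H^T = M.+1%:R%:M ->
  exists A : 'M[int]_(M, M.+1), ENTIF A.
Proof.
case/first_row_const => q q0 [G eG rG].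
pose c := q ^+ 2 * M.+1%:R.
have c0 : 0 < c by rewrite mulr_gt0 ?ltr0n // lt_def sqrf_eq0 q0 sqr_ge0.
have eA : row' 0 G *m (row' 0 G)^T = c%:M.
  apply/matrixP => i j; have /matrixP/(_ (lift 0 i) (lift 0 j)) := eG.
  rewrite !mxE (inj_eq lift_inj) => <-.
  by apply: eq_bigr => k _; rewrite !mxE.
exists (row' 0 G); split; last 1 first.
- have eG' : G^T *m G = c%:M.
    suff /matrixP e : map_mx (intr : int -> rat) (G^T *m G) = map_mx intr c%:M.
      by apply/matrixP => i j; apply: (@intr_inj rat); have := e i j; rewrite !mxE.
    rewrite map_mxM -map_trmx map_scalar_mx; apply: mulmx_tr_scalarC.
      by rewrite intr_eq0 gt_eqF.
    by rewrite map_trmx -map_mxM eG map_scalar_mx.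
  suff S j : \sum_(i < M) row' 0 G i j ^+ 2 = c - q ^+ 2 by move=> j j'; rewrite !S.
  have /matrixP/(_ j j) := eG'; rewrite !mxE eqxx mulr1n big_ord_recl => <-.
  have := congr1 (fun X : 'rV_M.+1 => X 0 j) rG; rewrite !mxE => ->.
  rewrite -expr2 addrAC subrr add0r.
  by apply: eq_bigr => i _; rewrite !mxE expr2.
- apply: (@mul_tr_scalar_rank _ _ _ _ c%:~R); first by rewrite intr_eq0 gt_eqF.
  by rewrite map_trmx -map_mxM eA map_scalar_mx.
- by exists c.
Qed.

Lemma entif_kernel_vector M (A : 'M[int]_(M, M.+1)) (lambda : int) : 0 < lambda ->
  A *m A^T = lambda%:M ->
  (forall j j', \sum_(i < M) A i j ^+ 2 = \sum_(i < M) A i j' ^+ 2) ->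
  exists2 e : 'rV[rat]_M.+1, e *m e^T = M.+1%:R%:M & e *m (map_mx intr A)^T = 0.
Proof.
move=> l0 eA eqn; set B := map_mx intr A.
have ln0 : lambda%:~R != 0 :> rat by rewrite intr_eq0 gt_eqF.
have eB : B *m B^T = lambda%:~R%:M by rewrite map_trmx -map_mxM eA map_scalar_mx.
have [v v0 vB] : exists2 v : 'rV[rat]_M.+1, v != 0 & v *m B^T = 0.
  exists (nz_row (kermx B^T)); last by apply/sub_kermxP; rewrite nz_row_sub.
  rewrite nz_row_eq0 -mxrank_eq0 mxrank_ker mxrank_tr (mul_tr_scalar_rank ln0 eB).
  by rewrite subSnn.
pose s := (v *m v^T) 0 0; have es : v *m v^T = s%:M by exact: mx11_scalar.
have s0 : s != 0 by apply: contra_neq v0; exact: mul_tr_row00_eq0.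
have Bv : B *m v^T = 0 by rewrite -[B]trmxK -trmx_mul vB trmx0.
(* The inverse on the other side resolves the identity into projections; its diagonal shows that all
   [v 0 j ^+ 2] are equal, so dividing by [v 0 0] gives signs. *)
have inv : col_mx v B *m row_mx (s^-1 *: v^T) (lambda%:~R^-1 *: B^T) = 1%:M.
  rewrite mul_col_row -!scalemxAr es eB vB Bv !scaler0 !scale_scalar_mx !mulVf //.
  by rewrite -scalar_mx_block.
have := mulmx1C inv; rewrite mul_row_col -!scalemxAl => part.
pose c := \sum_(i < M) A i 0 ^+ 2.
have vj j : v 0 j ^+ 2 = s * (1 - c%:~R / lambda%:~R).
  suff e : s^-1 * v 0 j ^+ 2 + lambda%:~R^-1 * c%:~R = 1.
    by rewrite -[X in X - _]e; field; rewrite s0 ln0.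
  have -> : c%:~R = \sum_i B^T j i * B i j.
    rewrite /c -(eqn j) rmorph_sum; apply: eq_bigr => i _.
    by rewrite !mxE rmorphXn /= expr2.
  have /matrixP/(_ j j) := part; rewrite !mxE eqxx big_ord1 !mxE -expr2.
  exact.
have v00 : v 0 0 != 0.
  apply: contra_neq v0 => z; apply/rowP => j; rewrite [RHS]mxE; apply/eqP.
  by rewrite -sqrf_eq0 vj -(vj 0) z expr0n.
exists ((v 0 0)^-1 *: v); last by rewrite -scalemxAl vB scaler0.
apply/matrixP => i j; rewrite !ord1 mul_tr_row00 [RHS]mxE mulr1n.
rewrite (eq_bigr (fun=> 1)) ?sumr_const ?card_ord // => k _.
by rewrite mxE exprMn vj -(vj 0) -exprMn mulVf ?expr1n.
Qed.

(** * Residues of squares and the two implications *)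

Lemma odd_of_sqr_add_sqr a b : ((a ^ 2 + b ^ 2) %% 4 = 2)%N -> odd a && odd b.
Proof.
have ea := odd_double_half a; have eb := odd_double_half b.
rewrite -{1}ea -{1}eb; move: (odd a) (odd b) a./2 b./2 {ea eb} => [] [] x y //; lia.
Qed.

Lemma sum_odd_squares_mod8 (s : seq nat) : all odd s ->
  (\sum_(x <- s) x ^ 2 = size s %[mod 8])%N.
Proof.
elim: s => [|x s IH] /=; first by rewrite big_nil.
case/andP=> ox /IH {}IH; rewrite big_cons -modnDmr IH modnDmr.
suff h : (x ^ 2 = 1 %[mod 8])%N by rewrite -modnDml h modnDml add1n.
have : (x %% 8 \in [:: 1; 3; 5; 7])%N by rewrite !inE; lia.
rewrite -modnXm !inE => /or4P[] /eqP -> //.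
Qed.

(** Odd squares are 1 modulo 8, so M + 1 is [k] modulo 8. For [k] = 1 and 2 the given roots form the
    blocks; for 4 and 8, 4 divides M + 1 and Lagrange's theorem for M + 1 supplies blocks of size
    4. *)
Lemma entif_of_sum_of_odd_squares M k : k \in [:: 1; 2; 4; 8]%N ->
  sum_of_odd_squares M.+1 k -> exists A : 'M[int]_(M, M.+1), ENTIF A.
Proof.
move=> hk /sum_of_odd_squares_seq [s [ss os es]].
have m8 := sum_odd_squares_mod8 os; rewrite es ss in m8.
suff [H eH] : exists H : 'M[int]_M.+1, H *m H^T = M.+1%:R%:M.
  exact: entif_of_mul_tr eH.
have four : (4 %| M.+1)%N -> exists H : 'M[int]_M.+1, H *m H^T = M.+1%:R%:M.
  move=> d4; apply: (block_diag_mul_tr d4).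
  have [a [b [c [d e]]]] := four_squares M.+1.
  have [H eH] := four_squares_mul_tr a b c d.
  by exists H; rewrite eH -e natz.
move: hk m8; rewrite !inE => /or4P[] /eqP ek; rewrite ek => m8.
- case: s ss os es => [|a [|? ?]] ; rewrite ek //= => _ _.
  rewrite big_cons big_nil addn0 => e; exists (a%:R%:M).
  by rewrite tr_scalar_mx -scalar_mxM -natrM mulnn e.
- case: s ss os es => [|a [|b [|? ?]]]; rewrite ek //= => _ _.
  rewrite !big_cons big_nil addn0 => e.
  apply: (@block_diag_mul_tr _ _ 2); first by lia.
  have [H eH] := two_squares_mul_tr (a%:R : int) b%:R.
  by exists H; rewrite eH -e natrD !natrX.
- by apply: four; lia.
- by apply: four; lia.
Qed.

Lemma sum_of_odd_squares_of_entif M (A : 'M[int]_(M, M.+1)) : ENTIF A ->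
  exists2 k : nat, k \in [:: 1; 2; 4; 8]%N & sum_of_odd_squares M.+1 k.
Proof.
case=> _ [lambda l0 eA] eqn.
have [e ee eB] := entif_kernel_vector l0 eA eqn.
set B := map_mx intr A in eB; pose L : rat := lambda%:~R.
have L0 : L != 0 by rewrite intr_eq0 gt_eqF.
have BB : B *m B^T = L%:M by rewrite map_trmx -map_mxM eA map_scalar_mx.
have Be : B *m e^T = 0 by rewrite -[B]trmxK -trmx_mul eB trmx0.
(* Used with t = 1 for the determinant, then with the [t] that makes both diagonal blocks equal. *)
have CC (t : rat) : col_mx e (t *: B) *m (col_mx e (t *: B))^T
    = block_mx M.+1%:R%:M 0 0 (t ^+ 2 * L)%:M.
  rewrite tr_col_mx mul_col_row ee linearZ /= -!scalemxAr -!scalemxAl eB Be BB.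
  by rewrite !scaler0 scalerA scale_scalar_mx expr2.
have := congr1 determinant (CC 1); rewrite det_mulmx det_tr det_ublock !det_scalar.
rewrite expr1 expr1n mul1r -expr2; set dC := \det _ => dE.
case: (boolP (odd M)) => oM; last first.
  have [k ek] : exists k, M.+1 = (k ^ 2)%N.
    apply: (@rational_square_nat _ (dC / L ^+ M./2)).
    rewrite expr_div_n dE -exprM muln2 even_halfK // mulfK ?expf_neq0 //.
  exists 1%N => //; apply/sum_of_odd_squares_seq; exists [:: k]; split=> //=.
    rewrite andbT; have : odd (k ^ 2) by rewrite -ek /= oM.
    by rewrite oddX.
  by rewrite big_cons big_nil addn0 ek.
have [d4|d4] := eqVneq (M.+1 %% 4)%N 0%N.
  have [d8|d8] := eqVneq (M.+1 %% 8)%N 0%N.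
    by exists 8%N => //; apply: sum_of_odd_squares8.
  by exists 4%N => //; apply: sum_of_odd_squares4; lia.
(* For odd [M], removing the even power of [L] leaves a square root of (M + 1) [L]; the scale (M +
   1)/[s] then gives t^2 L = M + 1. *)
pose s := dC / L ^+ M./2.
have es : s ^+ 2 = M.+1%:R * L.
  rewrite expr_div_n dE -exprM muln2 -[in L ^+ M](odd_double_half M) oM exprD.
  by rewrite mulrA mulfK ?expf_neq0 // expr1.
have s0 : s != 0 by rewrite -sqrf_eq0 es mulf_neq0 ?pnatr_eq0.
have := CC (M.+1%:R / s); rewrite expr_div_n es.
have n0 : M.+1%:R != 0 :> rat by rewrite pnatr_eq0.
have -> : M.+1%:R ^+ 2 / (M.+1%:R * L) * L = M.+1%:R.
  rewrite -[RHS](mulfK (mulf_neq0 n0 L0)); ring.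
rewrite -scalar_mx_block; move: (col_mx _ _) => C eC.
have Mk : M.+1 = (M.+1 %/ 4 * 4 + 2)%N by lia.
have [x [y exy]] := bruck_ryser Mk (ltn0Sn M) eC.
have [a [b eab]] := two_rational_squares exy.
exists 2%N => //; apply/sum_of_odd_squares_seq; exists [:: a; b]; split=> //=.
  by rewrite andbT; apply: odd_of_sqr_add_sqr; rewrite -eab; lia.
by rewrite !big_cons big_nil addn0 eab.
Qed.

Theorem theorem5p4 (M : nat) (hM : (0 < M)%N) :
  (exists A : 'M[int]_(M, M.+1), ENTIF A) <->
  (exists2 k : nat, k \in [:: 1; 2; 4; 8]%N & sum_of_odd_squares M.+1 k).
Proof.
split=> [[A]|[k]]; first exact: sum_of_odd_squares_of_entif.
exact: entif_of_sum_of_odd_squares.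
Qed.
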